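(* (1) There exist $\varphi$-equivalent sequences $\overline a,\overline b$ such that $G_\varphi$ is a path and $\mathcal L_\varphi(n)=\Omega(n\log\log n)$. (2) For every integer $m\ge 2$ there exist $\varphi$-equivalent sequences $\overline a,\overline b$ such that $G_\varphi$ contains only cycles of length $\le m$ and $\mathcal L_\varphi(n)=\Omega(n^{m-1-\varepsilon})$ for every $\varepsilon>0$. (3) There exist $\varphi$-equivalent sequences $\overline a,\overline b$ such that $\mathcal L_\varphi(n)=\exp\Omega(\sqrt[3]{n})$.
   Context: $\mathbb P$ is the set of positive integers. A partition $\lambda$ is a finite multiset of positive integers; $m_i(\lambda)$ is the number of parts equal to $i$ and $|\lambda|$ the sum of the parts. Sequences $\overline a=(a_1,a_2,\dots)$, $\overline b=(b_1,b_2,\dots)$ have entries in $\mathbb P\cup\{\infty\}$, and $\operatorname{supp}(\overline a)=\{i:a_i<\infty\}$. They are $\varphi$-equivalent if $\varphi\colon\operatorname{supp}(\overline a)\to\operatorname{supp}(\overline b)$ is a bijection with $ia_i=\varphi(i)b_{\varphi(i)}$ for all $i\in\operatorname{supp}(\overline a)$. $\mathcal A$ is the set of partitions $\lambda$ with $m_i(\lambda)<a_i$ for all $i$, and $\mathcal A_n$ those of size $n$. O'Hara's algorithm: on input $\lambda\in\mathcal A$, set $\mu\leftarrow\lambda$; while there is $j$ with $m_j(\mu)\ge b_j$, remove $b_j$ copies of $j$ and add $a_i$ copies of $i$, where $\varphi(i)=j$; output $\mu$ (the number of steps is known to be finite and independent of choices). $L_\varphi(\lambda)$ is the number of steps on input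 $\lambda$ and $\mathcal L_\varphi(n)=\max_{\lambda\in\mathcal A_n}L_\varphi(\lambda)$. $G_\varphi$ is the directed graph on $\operatorname{supp}(\overline a)\cup\operatorname{supp}(\overline b)$ with an edge $i\to j$ whenever $\varphi(j)=i$. *)

(* Defs.v *)
From HB Require Import structures.
From mathcomp Require Import all_boot all_order all_algebra.
From mathcomp Require Import finmap multiset.
From mathcomp Require Import all_classical all_reals all_analysis.
From Stdlib Require Import Relation_Operators.

Set Implicit Arguments.
Unset Strict Implicit.
Unset Printing Implicit Defensive.

Import Order.TTheory GRing.Theory Num.Theory.

Local Open Scope classical_set_scope.

Definition posint := {n : nat | 0 < n}.

Definition intpart := {mset posint}%mset.

(* For [la : intpart], [la i] is the multiplicity of [i] in [la]. *)
Definition psize (la : intpart) : nat := \sum_(i <- enum_mset la) val i.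

(* [None] stands for infinity. *)
Definition extseq := posint -> option posint.

Definition supp (a : extseq) : set posint := [set i | a i <> None].

(* Values of [phi] outside [supp a] are irrelevant here and below. *)
Definition phi_equivalent (a b : extseq) (phi : posint -> posint) : Prop :=
  set_bij (supp a) (supp b) phi /\
  forall i k l, a i = Some k -> b (phi i) = Some l ->
    val i * val k = val (phi i) * val l.

Definition bounded_by (a : extseq) : set intpart :=
  [set la | forall i k, a i = Some k -> la i < val k].

Definition bounded_by_of_size (a : extseq) (n : nat) : set intpart :=
  [set la | bounded_by a la /\ psize la = n].

Definition ohara_step (a b : extseq) (phi : posint -> posint)
    (mu nu : intpart) : Prop :=
  exists i j k l,
    [/\ a i = Some k, b j = Some l, phi i = j, val l <= mu j &
        nu = ((mu `\` msetn (val l) j) `+` msetn (val k) i)%mset].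

Fixpoint ohara_steps (a b : extseq) (phi : posint -> posint) (k : nat)
    (mu nu : intpart) : Prop :=
  if k is k'.+1 then
    exists2 mu', ohara_step a b phi mu mu' & ohara_steps a b phi k' mu' nu
  else mu = nu.

(* The loop stops exactly when no multiplicity [m_j] reaches [b_j], that is,
   when the current partition lies in [bounded_by b].  For phi-equivalent [a]
   and [b] and [la] in [bounded_by a], complete runs on [la] exist and all have
   the same length, so the set below is a singleton. *)
Definition ohara_length (a b : extseq) (phi : posint -> posint)
    (la : intpart) : nat :=
  xget 0 [set k | exists2 mu, ohara_steps a b phi k la mu & bounded_by b mu].

(* The maximum over the empty set is 0. *)
Definition ohara_max_length (a b : extseq) (phi : posint -> posint)
    (n : nat) : nat :=
  \big[maxn/0]_(la \in bounded_by_of_size a n) ohara_length a b phi la.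

Definition ohara_vertices (a b : extseq) : set posint := supp a `|` supp b.

Definition ohara_edge (a : extseq) (phi : posint -> posint)
    (i j : posint) : Prop := supp a j /\ phi j = i.

(* A directed path, finite, or infinite in one or both directions: its vertices
   are indexed by a nonempty interval of integers. *)
Definition is_dipath (T : Type) (V : set T) (E : T -> T -> Prop) : Prop :=
  exists (I : set int) (f : int -> T),
    [/\ I !=set0, is_interval I, set_bij I V f &
        forall p q, I p -> I q -> (E (f p) (f q) <-> q = (p + 1)%R)].

(* A directed cycle of length [k]; for [k = 1] it is a loop. *)
Definition is_dicycle (T : Type) (k : nat) (V : set T) (E : T -> T -> Prop)
    : Prop :=
  exists f : 'I_k -> T,
    set_bij [set: 'I_k] V f /\ forall p q, E (f p) (f q) <-> q = ordS p.

Definition component (T : Type) (E : T -> T -> Prop) (v : T) : set T :=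
  [set w | clos_refl_sym_trans T E v w].

Definition only_dicycles_of_length_le (T : Type) (m : nat) (V : set T)
    (E : T -> T -> Prop) : Prop :=
  forall v, V v -> exists2 k, k <= m & is_dicycle k (component E v) E.

(* Main.v *)
(* A step at [j] does not disable a step elsewhere, so steps commute, both for
   the algorithm and for its reversal.  Hence all complete runs from a partition
   of [A] have the same length, no state is visited twice, and the algorithm
   stops.  The final state then determines enough about the number [f_i] of moves
   creating parts [i] to bound the length from below.

   Path: take [1 -> 2 -> 3 -> 6 -> 5 -> 10 -> ...] and start from [n] parts [1].
   Up to a loss that is polynomial in the position, the whole weight [n] crosses
   each edge [x -> 2 x] with [x] odd, in portions of size [2 x]; summing [n / 2 x]
   over the odd [x] up to a power of [n] even gives order [n log n].

   Cycles: on a cycle, start from the largest multiplicities [a_i - 1].  The final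
   state must then have multiplicities [b_i - 1], which forces all the numbers
   [i a_i (f_i + 1)] to be one common multiple of the weights [i a_i].  With [m]
   weights of size about [N] that are nearly pairwise coprime this is of order
   [N^m]; with the cycle on [N, ..., 2 N - 1] and the weights [i * (i - 1)] it is
   at least [2^N], for a partition of size of order [N^3]. *)

Require Import Defs.
From HB Require Import structures.
From mathcomp Require Import all_boot all_order all_algebra.
From mathcomp Require Import finmap multiset.
From mathcomp Require Import all_classical all_reals all_analysis.
From mathcomp Require Import zify ring lra.
From Stdlib Require Import Relation_Operators.

Set Implicit Arguments.
Unset Strict Implicit.
Unset Printing Implicit Defensive.

Import Order.TTheory GRing.Theory Num.Theory.

Local Open Scope classical_set_scope.

(** * Rewriting systems with the strong diamond property *)

Section Rewriting.
Variable T : Type.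
Implicit Type R : T -> T -> Prop.

Fixpoint nsteps R k x y : Prop :=
  if k is k'.+1 then exists2 z, R x z & nsteps R k' z y else x = y.

(** Closing the diamond with exactly one step on each side, not with a chain of steps, is what
    preserves run lengths. *)
Definition strong_diamond R :=
  forall x y z, R x y -> R x z -> y = z \/ exists2 w, R y w & R z w.

Definition terminal R x := forall y, ~ R x y.

Definition converse R x y := R y x.

Lemma nstepsSr R k x y z : nsteps R k x y -> R y z -> nsteps R k.+1 x z.
Proof.
elim: k x => [x -> Ryz|k IHk x [u Rxu uy] Ryz]; first by exists z.
by exists u => //; exact: IHk.
Qed.

Lemma nsteps_converse R k x y : nsteps R k x y -> nsteps (converse R) k y x.
Proof.
elim: k x => [x //|k IHk x [u Rxu uy]].
by apply: nstepsSr (IHk _ uy) _.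
Qed.

(** Any first step can be moved to the front of the terminating run without changing its length: the
    induction hypothesis, applied to the single step from [x1] to [w], puts [w] on a run to [y] that
    is one step shorter. *)
Lemma strong_diamond_nsteps R k l x y z : strong_diamond R ->
  nsteps R k x y -> terminal R y -> nsteps R l x z ->
  l <= k /\ nsteps R (k - l) z y.
Proof.
move=> dR; elim: k x l z => [x [|l] z //= -> ty|k IHk x [|l] z /=].
- by move<-.
- by case=> u /ty.
- by move=> [x1 Rxx1 x1y] ty <-; split => //; exists x1.
move=> [x1 Rxx1 x1y] ty [z1 Rxz1 z1z].
have z1y : nsteps R k z1 y.
  have [<-//|[w Rx1w Rz1w]] := dR _ _ _ Rxx1 Rxz1.
  have x1w : nsteps R 1 x1 w by exists w.
  have [k0 wy] := IHk _ _ _ x1y ty x1w.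
  by rewrite -(subnKC k0) add1n; exists w.
by have [lk zy] := IHk _ _ _ z1y ty z1z; rewrite subSS.
Qed.

(** Read backwards, both are complete runs from [y], so [strong_diamond_nsteps] compares their
    lengths in both directions. *)
Lemma nsteps_inj R k l x y : strong_diamond (converse R) ->
  terminal (converse R) x -> nsteps R k x y -> nsteps R l x y -> k = l.
Proof.
move=> dR tx /nsteps_converse xy /nsteps_converse xy'.
have [lk _] := strong_diamond_nsteps dR xy tx xy'.
have [kl _] := strong_diamond_nsteps dR xy' tx xy.
by apply/eqP; rewrite eqn_leq kl lk.
Qed.

(* A state reached at two different times would yield two reversed runs of
   different lengths ending at [x], so by the pigeonhole principle a run of
   length [#|F|] must stop. *)
Lemma nsteps_terminates R (P : set T) (F : finType) (code : T -> F) x :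
  strong_diamond (converse R) -> terminal (converse R) x ->
  P x -> (forall y z, P y -> R y z -> P z) ->
  (forall y z, P y -> P z -> code y = code z -> y = z) ->
  exists k y, nsteps R k x y /\ terminal R y.
Proof.
move=> dR tx Px PR Pinj; apply: contrapT => noend.
(* The value at a terminal state is arbitrary; by [noend] no such state occurs on the run. *)
have nxt_ex y : exists z, (exists z', R y z') -> R y z.
  have [[z Ryz]|nz] := pselect (exists z', R y z'); first by exists z.
  by exists y.
have [nxt nxtP] := choice nxt_ex.
have run k : nsteps R k x (iter k nxt x).
  elim: k => [//|k IHk]; apply: (nstepsSr IHk); rewrite iterS; apply: nxtP.
  apply: contrapT => nz; apply: noend; exists k, (iter k nxt x).
  by split=> // y Ry; apply: nz; exists y.
have Prun k : P (iter k nxt x).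
  elim: k => [//|k IHk]; apply: PR IHk _; rewrite iterS; apply: nxtP.
  apply: contrapT => nz; apply: noend; exists k, (iter k nxt x).
  by split=> // y Ry; apply: nz; exists y.
have : ~~ injectiveb (fun i : 'I_#|F|.+1 => code (iter i nxt x)).
  by apply/negP => /injectiveP/leq_card; rewrite card_ord ltnn.
case/injectivePn => i [j ij eqc].
have eqi := Pinj _ _ (Prun i) (Prun j) eqc.
have runi := run i; rewrite eqi in runi.
by move/negP: ij; apply; apply/eqP/val_inj; exact: nsteps_inj dR tx runi (run j).
Qed.

End Rewriting.

(** * Partitions *)

Definition pos (n : nat) : posint := insubd (exist (fun n => 0 < n) 1 isT) n.

Lemma val_pos n : 0 < n -> val (pos n) = n.
Proof. by move=> n0; rewrite /pos insubdK. Qed.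

Lemma valpK (i : posint) : pos (val i) = i.
Proof. by rewrite /pos valKd. Qed.

Lemma psizeD (A B : intpart) : psize (A `+` B)%mset = psize A + psize B.
Proof.
rewrite /psize -big_cat; apply: perm_big; apply/allP => x _ /=.
by rewrite count_cat !count_mem_mset msetE2.
Qed.

Lemma psize_msetn k (i : posint) : psize (msetn k i) = k * val i.
Proof. by rewrite /psize enum_msetn big_nseq iter_addn addn0 mulnC. Qed.

Lemma leq_psize (A : intpart) i : A i * val i <= psize A.
Proof.
rewrite /psize (@sum_mset _ A xpredT (fun i => val i)).
case: finsuppP => [//|iA].
by rewrite (big_fsetD1 i iA) leq_addr.
Qed.

Lemma leq_count_psize (A : intpart) i : A i <= psize A.
Proof. exact: leq_trans (leq_pmulr _ (valP i)) (leq_psize A i). Qed.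

(** Parts and multiplicities of a partition of [n] are at most [n], so this finite table determines
    it; index 0 merely repeats the part 1. *)
Definition mset_code n (A : intpart) : {ffun 'I_n.+1 -> 'I_n.+1} :=
  [ffun j : 'I_n.+1 => inord (A (pos j))].

Lemma mset_code_inj n (A B : intpart) : psize A = n -> psize B = n ->
  mset_code n A = mset_code n B -> A = B.
Proof.
move=> An Bn /ffunP eqAB; apply/msetP => i.
have [ni|ni] := ltnP n (val i).
  have zero (C : intpart) : psize C = n -> C i = 0.
    move=> Cn; have := leq_psize C i; rewrite Cn => Ci.
    by apply/eqP; rewrite -leqn0 leqNgt; apply/negP => C0; nia.
  by rewrite !zero.
have := eqAB (Ordinal (ni : val i < n.+1)).
rewrite !ffunE /= valpK => /(congr1 (@nat_of_ord _)).
by rewrite !inordK // ltnS -?An -?Bn ?leq_count_psize // An -Bn leq_count_psize.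
Qed.

Lemma finite_psize n : finite_set [set la : intpart | psize la = n].
Proof.
have inj : {in [set la : intpart | psize la = n] &, injective (mset_code n)}.
  by move=> A B; rewrite !inE => An Bn; exact: mset_code_inj.
rewrite -(eq_finite_set (inj_card_eq inj)).
exact: finite_finset.
Qed.

(** * Chip-firing moves *)

Section Moves.
Variables (D : set posint) (s t : posint -> posint) (l k : posint -> nat).

(** Sources and targets play symmetric roles, so that the reversed moves are an instance as well. *)
Definition move_step (mu nu : intpart) : Prop :=
  exists2 i, D i & l i <= mu (s i) /\
    nu = ((mu `\` msetn (l i) (s i)) `+` msetn (k i) (t i))%mset.

(** Different moves draw on different parts and adding parts never blocks a move, so two moves can
    be made in either order. *)
Lemma move_diamond : {in D &, injective s} -> strong_diamond move_step.
Proof.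
move=> s_inj mu _ _ [i Di [li ->]] [j Dj [lj ->]].
have [<-|ij] := eqVneq i j; first by left.
have sij : s i != s j.
  by apply: contraNN ij => /eqP sE; apply/eqP/s_inj; rewrite ?inE.
right; exists ((mu `\` msetn (l i) (s i) `\` msetn (l j) (s j))
   `+` msetn (k i) (t i) `+` msetn (k j) (t j))%mset.
- exists j => //; split.
    by rewrite !msetE2 !msetnE eq_sym (negbTE sij); lia.
  apply/msetP => x; rewrite !msetE2 !msetnE.
  have [->|_] := eqVneq x (s i); first by rewrite (negbTE sij); lia.
  by have [->|_] := eqVneq x (s j); lia.
- exists i => //; split.
    by rewrite !msetE2 !msetnE (negbTE sij); lia.
  apply/msetP => x; rewrite !msetE2 !msetnE.
  have [->|_] := eqVneq x (s i); first by rewrite (negbTE sij); lia.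
  by have [->|_] := eqVneq x (s j); lia.
Qed.

End Moves.

Lemma move_step_converse D s t l k mu nu :
  move_step D s t l k mu nu -> move_step D t s k l nu mu.
Proof.
move=> [i Di [li ->]]; exists i => //; split.
  by rewrite !msetE2 msetnxx leq_addl.
apply/msetP => x; rewrite !msetE2 !msetnE.
by case: (x =P s i) => [->|_]; lia.
Qed.

(** * O'Hara's algorithm *)

(* The value [0] encodes infinity here; bounds are otherwise positive. *)
Definition bnd (a : extseq) (i : posint) : nat :=
  if a i is Some k then val k else 0.

Section OHara.
Variables (a b : extseq) (phi : posint -> posint).
Hypothesis ab : phi_equivalent a b phi.

(** Moves are indexed by the part they create: the source map is then [phi], injective on [supp a],
    and that of the reversal is the identity. *)
Lemma ohara_stepE : ohara_step a b phi =
  move_step (supp a) phi id (bnd b \o phi) (bnd a).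
Proof.
have [[phiD _ _] _] := ab.
apply/funext => mu; apply/funext => nu; apply/propext; split.
  move=> [i [j [k [l [ai bj phij lmu ->]]]]].
  by exists i; rewrite /supp /bnd /= ?phij ?ai ?bj.
move=> [i si [lmu ->]].
move: (si) (phiD _ si) lmu; rewrite /supp /bnd /=.
case ai: (a i) => [k|//] _; case bi: (b (phi i)) => [l|//] _ lmu.
by exists i, (phi i), k, l.
Qed.

Lemma ohara_step_diamond : strong_diamond (ohara_step a b phi).
Proof. by rewrite ohara_stepE; apply: move_diamond; case: ab => -[]. Qed.

Lemma ohara_converse_diamond : strong_diamond (converse (ohara_step a b phi)).
Proof.
rewrite ohara_stepE.
have -> : converse (move_step (supp a) phi id (bnd b \o phi) (bnd a)) =
    move_step (supp a) id phi (bnd a) (bnd b \o phi).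
  apply/funext => mu; apply/funext => nu; apply/propext.
  by split; exact: move_step_converse.
by apply: move_diamond => i j.
Qed.

Lemma ohara_terminalP mu : terminal (ohara_step a b phi) mu <-> bounded_by b mu.
Proof.
have [[_ _ phi_surj] _] := ab; split=> [tmu j l bj|bmu nu].
  rewrite ltnNge; apply/negP => lmu.
  have [|i si ij] := phi_surj j; first by rewrite /supp /= bj.
  apply: tmu; rewrite ohara_stepE; exists i => //=; split; last by [].
  by rewrite ij /bnd bj.
move=> [i [j [k [l [_ /bmu + _ lmu _]]]]].
by rewrite ltnNge lmu.
Qed.

(** A step creating parts [i] leaves at least [a_i] of them, so no step ends in a partition bounded
    by [a]. *)
Lemma bounded_by_converse_terminal la :
  bounded_by a la -> terminal (converse (ohara_step a b phi)) la.
Proof.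
move=> bla mu [i [j [k [l [/bla + _ _ _ lmu]]]]].
by rewrite lmu !msetE2 msetnxx ltnNge leq_addl.
Qed.

Lemma psize_ohara_step mu nu : ohara_step a b phi mu nu -> psize nu = psize mu.
Proof.
move=> [i [j [k [l [ai bj phij lmu nuE]]]]].
have [_ wt] := ab; have := wt i k l ai; rewrite phij => /(_ bj) kl.
(* Putting the removed parts back on both sides avoids the truncated difference. *)
have : psize (nu `+` msetn (val l) j)%mset = psize (mu `+` msetn (val k) i)%mset.
  congr psize; apply/msetP => x; rewrite nuE !msetE2 !msetnE.
  by case: (x =P j) => [->|_]; lia.
rewrite !psizeD !psize_msetn; lia.
Qed.

Lemma ohara_stepsE k mu nu :
  ohara_steps a b phi k mu nu = nsteps (ohara_step a b phi) k mu nu.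
Proof.
elim: k mu => [//|k IHk] mu /=.
by apply/propext; split=> -[mu' step]; [rewrite IHk|rewrite -IHk]; exists mu'.
Qed.

Lemma ohara_terminates la : bounded_by a la ->
  exists k mu, nsteps (ohara_step a b phi) k la mu /\ bounded_by b mu.
Proof.
move=> bla.
have [||k [mu [run /ohara_terminalP tmu]]] := nsteps_terminates
   (P := [set mu | psize mu = psize la]) (code := mset_code (psize la))
   ohara_converse_diamond (bounded_by_converse_terminal bla) erefl.
- by move=> mu nu /= + /psize_ohara_step ->.
- by move=> mu nu; exact: mset_code_inj.
- by exists k, mu.
Qed.

Lemma ohara_lengthP la mu k :
  nsteps (ohara_step a b phi) k la mu -> bounded_by b mu ->
  ohara_length a b phi la = k.
Proof.
move=> run bmu; rewrite /ohara_length; case: xgetP => [l _ [nu]|/(_ k)].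
  rewrite ohara_stepsE => run' bnu.
  have tmu := (ohara_terminalP mu).2 bmu; have tnu := (ohara_terminalP nu).2 bnu.
  have [lk _] := strong_diamond_nsteps ohara_step_diamond run tmu run'.
  have [kl _] := strong_diamond_nsteps ohara_step_diamond run' tnu run.
  by apply/eqP; rewrite eqn_leq kl lk.
by case; exists mu; rewrite ?ohara_stepsE.
Qed.

Lemma leq_ohara_max_length n la : bounded_by_of_size a n la ->
  ohara_length a b phi la <= ohara_max_length a b phi n.
Proof.
move=> Hla; rewrite /ohara_max_length.
(* The maximum is taken over the finite support of the length function, so the value 0 is treated
   apart. *)
have [->//|L0] := eqVneq (ohara_length a b phi la) 0.
apply: leq_bigmax_seq => //.
rewrite in_finite_support; first by rewrite inE; split=> //=; exact/eqP.
by apply: sub_finite_set (finite_psize n) => mu [[]].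
Qed.

(* [f i] counts the moves that create parts [i]. *)
Lemma ohara_step_counts k la mu : nsteps (ohara_step a b phi) k la mu ->
  exists f : posint -> nat,
    (forall i, supp a i ->
       mu (phi i) + bnd b (phi i) * f i = la (phi i) + bnd a (phi i) * f (phi i))
    /\ (forall r, uniq r -> \sum_(i <- r) f i <= k).
Proof.
have [[_ phi_inj _] _] := ab.
rewrite ohara_stepE; elim: k la => [la <-|k IHk la].
  by exists (fun=> 0); split=> [i _|r _]; rewrite ?muln0 ?big1.
move=> [nu [i si [lla nuE]]] /IHk [f [fP fk]].
exists (fun x => f x + (x == i)); split=> [j sj|r ur].
  have := fP j sj; rewrite nuE !msetE2 !msetnE /=.
  have [->|ji] := eqVneq j i.
    rewrite eqxx; move: lla => /=; case: (phi i =P i) => [->|_]; lia.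
  have -> : (phi j == phi i) = false.
    by apply/negbTE; apply: contraNN ji => /eqP pE; apply/eqP/phi_inj; rewrite ?inE.
  case: (phi j =P i) => [->|_]; lia.
rewrite big_split /= -[k.+1]addn1 leq_add ?fk //.
rewrite -[X in X <= _](_ : count_mem i r = _); first by rewrite count_uniq_mem // leq_b1.
by rewrite -sum1_count big_mkcond; apply: eq_bigr => x _ /=; case: eqP.
Qed.

(** The balance at [phi i] over a complete run: final plus removed copies equal initial plus created
    ones. Where [a] is infinite, [bnd a] is 0, in accordance with no move creating that part. *)
Lemma ohara_counts n la : bounded_by_of_size a n la ->
  exists (f : posint -> nat) (mu : intpart), [/\ bounded_by b mu,
    forall i, supp a i ->
      mu (phi i) + bnd b (phi i) * f i = la (phi i) + bnd a (phi i) * f (phi i) &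
    forall r, uniq r -> \sum_(i <- r) f i <= ohara_max_length a b phi n].
Proof.
move=> Hla; have [k [mu [run bmu]]] := ohara_terminates Hla.1.
have [f [fP fk]] := ohara_step_counts run.
exists f, mu; split=> // r /fk /leq_trans; apply.
by rewrite -(ohara_lengthP run bmu) leq_ohara_max_length.
Qed.

End OHara.

(** * The path *)

(* The path is [1 -> 2 -> 3 -> 6 -> 5 -> 10 -> 7 -> 14 -> ...]: every odd [x] is
   followed by [2 x] and then by [x + 2].  The weight [i * a_i] moved along the
   edge ending at [i] is the least common multiple of its two ends. *)
Definition path_vertex (k : nat) : nat := if odd k then 2 * k else k.+1.

(** One step back on the path, since the edge into [x] starts at [phi x]. *)
Definition path_phi (x : posint) : posint :=
  pos (if odd (val x) then 2 * (val x - 2) else (val x)./2).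

(** The initial vertex 1 has no incoming edge, and multiples of 4 lie off the path. *)
Definition path_a : extseq := fun x =>
  if val x == 1 then None
  else if odd (val x) then Some (pos (2 * (val x - 2)))
  else if val x %% 4 == 2 then Some (pos 1) else None.

Definition path_b : extseq := fun x =>
  if odd (val x) then Some (pos 2)
  else if val x %% 4 == 2 then Some (pos ((val x)./2 + 2)) else None.

Lemma supp_path_aE x : supp path_a x <-> val x %% 4 != 0 /\ val x != 1.
Proof.
rewrite /supp /path_a /=.
case: ifP => x1; first by split=> // -[? ?]; lia.
case: ifP => ox; first by split=> // _; split=> //; lia.
by case: ifP => x4; split=> //; [move=> _; split=> //; lia | case; lia].
Qed.

Lemma supp_path_bE x : supp path_b x <-> val x %% 4 != 0.
Proof.
rewrite /supp /path_b /=.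
case: ifP => ox; first by split=> // _; lia.
by case: ifP => x4; split=> //; lia.
Qed.

Lemma posP (x : posint) : 0 < val x. Proof. exact: valP. Qed.

Lemma val_path_phi x : supp path_a x ->
  val (path_phi x) = if odd (val x) then 2 * (val x - 2) else (val x)./2.
Proof.
by move=> /supp_path_aE[x4 x1]; rewrite val_pos //; case: ifP => ?; lia.
Qed.

Lemma path_equiv : phi_equivalent path_a path_b path_phi.
Proof.
split; first split.
- move=> x sx; apply/supp_path_bE; rewrite val_path_phi //.
  by move/supp_path_aE: sx => [x4 x1]; case: ifP => ?; lia.
- move=> x y; rewrite !inE => sx sy /(congr1 val); rewrite !val_path_phi //.
  move/supp_path_aE: sx => [x4 x1]; move/supp_path_aE: sy => [y4 y1].
  by move=> e; apply: val_inj; move: e; do 2![case: ifP => ?]; lia.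
- move=> j /supp_path_bE j4.
  pose i := pos (if odd (val j) then 2 * val j else (val j)./2 + 2).
  have vi : val i = if odd (val j) then 2 * val j else (val j)./2 + 2.
    by rewrite val_pos //; have := posP j; case: ifP => ?; lia.
  have si : supp path_a i.
    by apply/supp_path_aE; rewrite vi; have := posP j; split; case: ifP; lia.
  exists i => //; apply: val_inj; rewrite val_path_phi // vi.
  move: (val j) (posP j) j4 => m m0 m4.
  by case: (boolP (odd m)) => om /=; case: ifP; lia.
- move=> i k l ai bi; have si : supp path_a i by rewrite /supp /= ai.
  move: ai bi; rewrite /path_a /path_b val_path_phi //.
  move/supp_path_aE: si => [i4 i1]; rewrite (negbTE i1).
  move: (val i) (posP i) i4 i1 => m m0 m4 m1.
  case: (boolP (odd m)) => om /=; last first.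
    by rewrite !ifT; [move=> [<-] [<-]; rewrite !val_pos| |]; lia.
  rewrite ifF ?ifT; [|lia|lia].
  have -> : (2 * (m - 2))./2 + 2 = m by lia.
  by move=> [<-] [<-]; rewrite !val_pos ?[m * _]mulnC; lia.
Qed.

Lemma path_vertex_gt0 k : 0 < path_vertex k.
Proof. by rewrite /path_vertex; case: ifP; lia. Qed.

Lemma path_vertex_inj : injective path_vertex.
Proof. by move=> p q; rewrite /path_vertex; do 2![case: ifP => ?]; lia. Qed.

Lemma supp_path_vertexS k : supp path_a (pos (path_vertex k.+1)).
Proof.
apply/supp_path_aE; rewrite val_pos ?path_vertex_gt0 // /path_vertex /=.
by split; case: ifP; lia.
Qed.

Lemma path_phi_vertex k :
  path_phi (pos (path_vertex k.+1)) = pos (path_vertex k).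
Proof.
apply: val_inj; rewrite val_path_phi; last exact: supp_path_vertexS.
rewrite !val_pos ?path_vertex_gt0 // /path_vertex /=.
by case: (boolP (odd k)) => ok /=; case: ifP; lia.
Qed.

Lemma path_is_dipath :
  is_dipath (ohara_vertices path_a path_b) (ohara_edge path_a path_phi).
Proof.
exists [set p : int | (0 <= p)%R], (fun p : int => pos (path_vertex `|p|%N)).
split.
- by exists 0%R => /=.
- move=> x y /= x0 y0 z /andP[xz _]; exact: le_trans x0 xz.
- split.
  + move=> p /= p0; right; apply/supp_path_bE.
    rewrite val_pos ?path_vertex_gt0 // /path_vertex.
    by case: ifP; lia.
  + move=> p q; rewrite !inE /= => p0 q0 /(congr1 val).
    by rewrite !val_pos ?path_vertex_gt0 // => /path_vertex_inj; lia.
  + move=> x Vx; have x4 : val x %% 4 != 0.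
      by case: Vx => [/supp_path_aE[]|/supp_path_bE].
    exists (Posz (if odd (val x) then (val x).-1 else (val x)./2)) => //.
    apply: val_inj; rewrite absz_nat val_pos ?path_vertex_gt0 // /path_vertex.
    move: (val x) (posP x) x4 => m m0 m4.
    by case: (boolP (odd m)) => om /=; case: ifP; lia.
- move=> [p|//] [q|//] _ _ /=; split=> [[sq /(congr1 val)]|].
    case: q sq => [|q] sq.
      by move/supp_path_aE: sq => [_]; rewrite val_pos.
    rewrite path_phi_vertex !val_pos ?path_vertex_gt0 // => /path_vertex_inj.
    by move=> ->; rewrite -addn1.
  move=> qp; have -> : q = p.+1 by lia.
  by split; [exact: supp_path_vertexS|exact: path_phi_vertex].
Qed.

(** Here [g j] counts the moves along [x -> 2 x] for [x = 2 j + 1], each carrying weight [4 j + 2].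
    Every vertex retains less than one portion, a loss quadratic in [j] per round and hence cubic in
    total. *)
Lemma path_counts n : exists g : nat -> nat,
  (forall j, n <= (4 * j + 2) * g j + 8 * j.+1 ^ 3) /\
  (forall K, \sum_(0 <= j < K) g j <= ohara_max_length path_a path_b path_phi n).
Proof.
(* Admissible for every [n] because [path_a] is infinite at 1. *)
pose la : intpart := msetn n (pos 1).
have Hla : bounded_by_of_size path_a n la.
  split; last by rewrite psize_msetn val_pos // muln1.
  move=> i k ai; rewrite msetnE; case: eqP => [i1|_]; last exact: posP.
  by move: ai; rewrite i1 /path_a val_pos.
have [f [mu [bmu fP fL]]] := ohara_counts path_equiv Hla.
pose g k := f (pos (path_vertex k)).
have gP k := fP _ (@supp_path_vertexS k).
have bE k : bnd path_b (pos (path_vertex k)) = if odd k then k + 2 else 2.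
  rewrite /bnd /path_b val_pos ?path_vertex_gt0 // /path_vertex.
  case: (boolP (odd k)) => ok; last by rewrite ifT ?val_pos //=; lia.
  by rewrite ifF ?ifT ?val_pos; lia.
have aE k : bnd path_a (pos (path_vertex k.+1)) = if odd k then 2 * k else 1.
  rewrite /bnd /path_a val_pos ?path_vertex_gt0 // /path_vertex /=.
  case: (boolP (odd k)) => ok /=; last first.
    by rewrite ifF 1?ifF 1?ifT ?val_pos; lia.
  by rewrite ok /= val_pos; lia.
have mu_lt k : mu (pos (path_vertex k)) < bnd path_b (pos (path_vertex k)).
  have : supp path_b (pos (path_vertex k)).
    have [[bf _ _] _] := path_equiv.
    by rewrite -path_phi_vertex; apply: bf; exact: supp_path_vertexS.
  by rewrite /supp /bnd /=; case bk: (path_b _) => [l|//] _; exact: bmu bk.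
have g0 : n < 2 * (g 1).+1.
  have := gP 0; have := mu_lt 0; rewrite !path_phi_vertex bE /= msetnxx.
  rewrite /bnd /path_a val_pos //= mul0n addn0 /g; lia.
(* All copies created at a vertex are passed on, except for less than one portion. *)
have gS k : bnd path_a (pos (path_vertex k.+1)) * g k.+1 <
            bnd path_b (pos (path_vertex k.+1)) * (g k.+2).+1.
  have := gP k.+1; have := mu_lt k.+1; rewrite path_phi_vertex msetnE.
  case: eqP => [/(congr1 val)|_]; last by rewrite /g mulnS; lia.
  rewrite !val_pos ?path_vertex_gt0 // /path_vertex; case: ifP; lia.
exists (fun j => g (2 * j).+1); split.
  elim=> [|j IHj]; first by move: g0; rewrite !muln0 exp1n; lia.
  have := gS (2 * j); have := gS (2 * j).+1; rewrite !aE !bE /=.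
  have -> : (2 * j.+1).+1 = (2 * j).+3 by lia.
  have -> : odd (2 * j) = false by lia.
  move: IHj; move: (g (2 * j).+1) (g (2 * j).+2) (g (2 * j).+3) => x y z.
  rewrite mul1n => IHj yz xy; apply: (leq_trans IHj).
  have {}xy := leq_mul (leqnn (4 * j + 2)) (ltnW xy).
  have {}yz : (4 * j + 6) * ((2 * j).+1 * y) <= (4 * j + 6) * z.+1.
    by move: yz; rewrite -mulnA ltn_mul2l leq_mul2l => /andP[_ /ltnW ->]; rewrite orbT.
  have e : (4 * j + 2) * (((2 * j).+1 + 2) * y.+1) =
    (4 * j + 6) * ((2 * j).+1 * y) + (4 * j + 2) * (2 * j + 3) by lia.
  (* The losses on the two edges from [2 x] to [2 (x + 2)] fit into one increment of the cubic
     term. *)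
  have : 8 * j.+1 ^ 3 + (4 * j + 2) * (2 * j + 3) + (4 * j + 6) <= 8 * j.+2 ^ 3.
    by rewrite !expnS expn0; clear; nia.
  have : (4 * j + 6) * z.+1 = (4 * j.+1 + 2) * z + (4 * j + 6) by lia.
  move: xy; rewrite {}e; move: yz.
  move: (8 * _) (8 * _) ((4 * j + 6) * _) ((4 * j + 6) * _) ((4 * j + 2) * x).
  move: ((4 * j + 2) * _) ((4 * j.+1 + 2) * z) => *; lia.
move=> K; have := fL [seq pos (path_vertex (2 * j).+1) | j <- index_iota 0 K].
rewrite big_map; apply.
rewrite map_inj_uniq ?iota_uniq // => p q /(congr1 val).
by rewrite !val_pos ?path_vertex_gt0 // => /path_vertex_inj; lia.
Qed.

(** * Unions of cycles *)

(** Finds the scale [t] to which [n] belongs; [t <= g t] bounds the search for the largest [t] with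
    [g t <= n]. *)
Lemma between_consecutive (g : nat -> nat) n : g 0 <= n ->
  (forall t, t <= g t) -> exists t, g t <= n < g t.+1.
Proof.
move=> g0 g_ge.
have [t gt maxt] := ex_maxnP (ex_intro (fun t => g t <= n) 0 g0)
  (fun t => leq_trans (g_ge t)).
exists t; rewrite gt ltnNge; apply/negP => /maxt; by rewrite ltnn.
Qed.

(** The chain of inequalities closes up after one turn. *)
Lemma cyclic_monotone_constant (G : nat -> nat) lo hi :
  (forall i, lo <= i -> i.+1 < hi -> G i <= G i.+1) -> G hi.-1 <= G lo ->
  forall i, lo <= i < hi -> G i = G lo.
Proof.
move=> Gmono Gcyc.
have mono i d : lo <= i -> i + d < hi -> G i <= G (i + d).
  elim: d => [|d IHd] loi; rewrite ?addn0 // addnS => idhi.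
  apply: leq_trans (IHd _ _) (Gmono _ _ idhi) => //; lia.
move=> i /andP[loi ihi]; apply/eqP; rewrite eqn_leq; apply/andP; split.
  apply: leq_trans Gcyc; have := mono i (hi.-1 - i) loi.
  by rewrite subnKC; [apply|]; lia.
by have := mono lo (i - lo) (leqnn _); rewrite subnKC //; apply.
Qed.

Lemma mset_of_counts (r : seq posint) (c : posint -> nat) : uniq r ->
  exists A : intpart, (forall x, A x = if x \in r then c x else 0) /\
    psize A = \sum_(x <- r) c x * val x.
Proof.
elim: r => [_|x r IHr /= /andP[xr /IHr[A [AE szA]]]].
  by exists mset0; split=> [x|]; rewrite ?mset0E // /psize enum_mset0 !big_nil.
exists (A `+` msetn (c x) x)%mset; split=> [y|].
  rewrite msetE2 msetnE inE AE; case: eqP => [->|_] /=; last by rewrite addn0.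
  by rewrite (negbTE xr).
by rewrite psizeD psize_msetn szA big_cons addnC.
Qed.

Section Blocks.
Variables (s W : nat -> nat).
Hypotheses (s0 : s 0 = 2) (s_lt : forall t, s t < s t.+1) (W_gt0 : forall i, 0 < W i).

(* The blocks [[s t, s t.+1)] partition the integers that are at least [2]; each
   of them is a cycle, and [1] is kept as an inert part. *)
Definition block (i : nat) : nat := xget 0 [set t | s t <= i < s t.+1].

Definition block_pred (i : nat) : nat :=
  if i == s (block i) then (s (block i).+1).-1 else i.-1.

Definition block_succ (i : nat) : nat :=
  if i.+1 == s (block i).+1 then s (block i) else i.+1.

Definition block_phi (x : posint) : posint := pos (block_pred (val x)).

(** The weight moved along the edge ending at [i]. The factor [i * block_pred i] makes it divisible
    by both ends of the edge, which leaves [W] free to be chosen. *)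
Definition block_weight (i : nat) : nat := i * block_pred i * W i.

Definition block_a : extseq := fun x =>
  if 1 < val x then Some (pos (block_pred (val x) * W (val x))) else None.

Definition block_b : extseq := fun x =>
  if 1 < val x then Some (pos (block_succ (val x) * W (block_succ (val x))))
  else None.

Lemma s_homo t t' : t <= t' -> s t <= s t'.
Proof. by apply: (@homo_leq _ s leq leqnn leq_trans) => u; exact: ltnW. Qed.

Lemma s_gt1 t : 1 < s t.
Proof. by have := s_homo (leq0n t); rewrite s0. Qed.

Lemma leq_s t : t <= s t.
Proof. by elim: t => // t IHt; exact: leq_ltn_trans (s_lt t). Qed.

Lemma block_uniq t i : s t <= i < s t.+1 -> block i = t.
Proof.
move=> /andP[ti it]; rewrite /block; case: xgetP => [u _ /andP[ui iu]|/(_ t)].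
  have [ut|tu|//] := ltngtP u t.
    by have := s_homo ut; lia.
  by have := s_homo tu; lia.
by case; rewrite /= ti.
Qed.

Lemma blockP i : 1 < i -> s (block i) <= i < s (block i).+1.
Proof.
move=> i1; have [|t ti] := @between_consecutive s i _ leq_s.
  by rewrite s0.
by rewrite (block_uniq ti).
Qed.

Lemma block_predP i : 1 < i ->
  s (block i) <= block_pred i < s (block i).+1.
Proof.
move=> i1; have := blockP i1; have := s_lt (block i); rewrite /block_pred.
by case: eqP; lia.
Qed.

Lemma block_succP i : 1 < i ->
  s (block i) <= block_succ i < s (block i).+1.
Proof.
move=> i1; have := blockP i1; have := s_lt (block i); rewrite /block_succ.
by case: eqP; lia.
Qed.

Lemma block_pred_gt1 i : 1 < i -> 1 < block_pred i.
Proof. by move=> /block_predP/andP[+ _]; apply: leq_trans; exact: s_gt1. Qed.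

Lemma block_succ_gt1 i : 1 < i -> 1 < block_succ i.
Proof. by move=> /block_succP/andP[+ _]; apply: leq_trans; exact: s_gt1. Qed.

Lemma block_block_pred i : 1 < i -> block (block_pred i) = block i.
Proof. by move=> i1; apply: block_uniq; exact: block_predP. Qed.

Lemma block_block_succ i : 1 < i -> block (block_succ i) = block i.
Proof. by move=> i1; apply: block_uniq; exact: block_succP. Qed.

Lemma block_predK i : 1 < i -> block_succ (block_pred i) = i.
Proof.
move=> i1; have bi := blockP i1; have st := s_lt (block i).
rewrite /block_succ block_block_pred // /block_pred.
by case: (i =P s (block i)) => [e|ne]; case: eqP => ?; lia.
Qed.

Lemma block_succK i : 1 < i -> block_pred (block_succ i) = i.
Proof.
move=> i1; have bi := blockP i1; have st := s_lt (block i).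
rewrite /block_pred block_block_succ // /block_succ.
by case: (i.+1 =P s (block i).+1) => [e|ne]; case: eqP => ?; lia.
Qed.

Lemma val_block_phi x : 1 < val x -> val (block_phi x) = block_pred (val x).
Proof. by move=> x1; rewrite val_pos // ltnW // block_pred_gt1. Qed.

Lemma supp_block_a x : supp block_a x <-> 1 < val x.
Proof. by rewrite /supp /block_a /=; case: ifP. Qed.

Lemma supp_block_b x : supp block_b x <-> 1 < val x.
Proof. by rewrite /supp /block_b /=; case: ifP. Qed.

Lemma bnd_block_a x : 1 < val x -> bnd block_a x = block_pred (val x) * W (val x).
Proof.
move=> x1; rewrite /bnd /block_a x1 val_pos //.
by rewrite muln_gt0 W_gt0 ltnW // block_pred_gt1.
Qed.

Lemma bnd_block_b x : 1 < val x ->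
  bnd block_b x = block_succ (val x) * W (block_succ (val x)).
Proof.
move=> x1; rewrite /bnd /block_b x1 val_pos //.
by rewrite muln_gt0 W_gt0 ltnW // block_succ_gt1.
Qed.

Lemma block_equiv : phi_equivalent block_a block_b block_phi.
Proof.
split; first split.
- move=> x /supp_block_a x1; apply/supp_block_b.
  by rewrite val_block_phi // block_pred_gt1.
- move=> x y; rewrite !inE => /supp_block_a x1 /supp_block_a y1 /(congr1 val).
  rewrite !val_block_phi // => e; apply: val_inj.
  by rewrite -(block_predK x1) e block_predK.
- move=> y /supp_block_b y1.
  have y1' := block_succ_gt1 y1.
  have vy : val (pos (block_succ (val y))) = block_succ (val y).
    by rewrite val_pos // ltnW.
  exists (pos (block_succ (val y))); first by apply/supp_block_a; rewrite vy.
  by apply: val_inj; rewrite val_block_phi vy // block_succK.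
- move=> i k l ai bi.
  have i1 : 1 < val i by apply/supp_block_a; rewrite /supp /= ai.
  have p1 := block_pred_gt1 i1.
  have := bnd_block_a i1; rewrite {1}/bnd ai => ->.
  have : bnd block_b (block_phi i) = val l by rewrite /bnd bi.
  rewrite bnd_block_b val_block_phi // block_predK // => <-.
  by rewrite mulnCA.
Qed.

Lemma block_edgeE (x y : posint) :
  ohara_edge block_a block_phi x y <-> 1 < val y /\ val x = block_pred (val y).
Proof.
split=> [[/supp_block_a y1 <-]|[y1 xy]]; first by rewrite val_block_phi.
split; first exact/supp_block_a.
by apply: val_inj; rewrite val_block_phi.
Qed.

Lemma component_blockP (x y : posint) : 1 < val x ->
  component (ohara_edge block_a block_phi) x y <->
  1 < val y /\ block (val y) = block (val x).
Proof.
pose E := ohara_edge block_a block_phi.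
move=> x1; split.
  rewrite /component /= => xy.
  (* The alternative [x = y] serves the reflexive case, where [1 < val x] is not at hand. *)
  have : (1 < val y /\ 1 < val x /\ block (val y) = block (val x)) \/ x = y.
    elim: xy {x1} => {x y}.
    + move=> x y /block_edgeE[y1 xy]; left.
      by rewrite xy block_block_pred // block_pred_gt1.
    + by move=> x; right.
    + by move=> x y _ [[? [? ?]]|->]; [left|right].
    + move=> x y z _ [[? [? xy]]|->] _ [[? [? yz]]|<-]; try by [left|right].
      by left; rewrite -xy yz.
  by case=> [[? []]|<-].
move=> [y1 yx].
(* Every vertex is linked to the first one of its block. *)
have conn t p : s t + p < s t.+1 ->
    clos_refl_sym_trans _ E (pos (s t)) (pos (s t + p)).
  elim: p => [|p IHp] tp; first by rewrite addn0; exact: rst_refl.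
  apply: rst_trans (IHp _) _; first lia.
  apply: rst_step; apply/block_edgeE.
  have st1 := s_gt1 t.
  rewrite !val_pos; [|lia|lia].
  split; first lia.
  have bt : block (s t + p.+1) = t by apply: block_uniq; lia.
  by rewrite /block_pred bt; case: eqP; lia.
have conn' (z : posint) : 1 < val z ->
    clos_refl_sym_trans _ E (pos (s (block (val z)))) z.
  move=> z1; have /andP[zl zr] := blockP z1.
  by have := conn (block (val z)) (val z - s (block (val z))); rewrite subnKC // valpK; apply.
apply: rst_trans (conn' _ y1); rewrite yx; apply: rst_sym; exact: conn'.
Qed.

Lemma block_only_dicycles m : (forall t, s t.+1 <= s t + m) ->
  only_dicycles_of_length_le m
    (ohara_vertices block_a block_b) (ohara_edge block_a block_phi).
Proof.
move=> sm v Vv.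
have v1 : 1 < val v by case: Vv => [/supp_block_a|/supp_block_b].
set t := block (val v); have st := s_lt t; have st1 := s_gt1 t.
exists (s t.+1 - s t); first by have := sm t; lia.
have bnd_p (p : 'I_(s t.+1 - s t)) : s t <= s t + p < s t.+1.
  by have := ltn_ord p; lia.
have val_p (p : 'I_(s t.+1 - s t)) : val (pos (s t + p)) = s t + p.
  by rewrite val_pos; lia.
exists (fun p => pos (s t + p)); split; first split.
- move=> p _; apply/component_blockP => //.
  by rewrite val_p (block_uniq (bnd_p p)); split; lia.
- move=> p q _ _ /(congr1 val); rewrite !val_p => /addnI; exact: ord_inj.
- move=> w /component_blockP -/(_ v1)[w1 wt].
  have := blockP w1; rewrite wt -/t => /andP[wl wr].
  have pt : val w - s t < s t.+1 - s t by lia.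
  exists (Ordinal pt) => //; apply: val_inj; rewrite val_p; exact: subnKC.
- move=> p q; split.
    move=> /block_edgeE[_]; rewrite !val_p /block_pred (block_uniq (bnd_p q)).
    move=> pq; apply: val_inj => /=; have := ltn_ord p; have := ltn_ord q.
    move: pq; case: eqP => [tq|tq] pq qt pt.
      have -> : p.+1 = s t.+1 - s t by lia.
      by rewrite modnn; lia.
    rewrite modn_small; lia.
  move=> qp; apply/block_edgeE; rewrite !val_p /block_pred (block_uniq (bnd_p q)).
  split; first lia.
  have := ltn_ord p => pt; have : val q = p.+1 %% (s t.+1 - s t) by rewrite qp.
  have [pS|pS] := eqVneq p.+1 (s t.+1 - s t).
    by rewrite pS modnn /= => ->; rewrite addn0 eqxx; lia.
  by rewrite modn_small /=; [move=> ->; case: eqP; lia|lia].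
Qed.

(* Starting from the largest admissible multiplicities [a_i - 1] on a block, the
   final multiplicities are at most [b_i - 1], so that
   [i * a_i * (f_i + 1)], where [f_i] counts the moves creating [i], cannot
   increase along [phi].  On a cycle it is therefore constant, hence a common
   multiple of the weights [i * a_i]. *)
Lemma block_counts t n : \sum_(s t <= i < s t.+1) block_weight i <= n ->
  exists G, 0 < G /\ forall i, s t <= i < s t.+1 -> block_weight i %| G /\
    G <= block_weight i * (ohara_max_length block_a block_b block_phi n).+1.
Proof.
move=> wn; have st1 := s_gt1 t.
pose r := [seq pos i | i <- index_iota (s t) (s t.+1)].
have ur : uniq (pos 1 :: r).
  rewrite /= map_inj_in_uniq ?iota_uniq ?andbT.
    apply/mapP => -[i]; rewrite mem_index_iota => it /(congr1 val).
    by rewrite !val_pos //; lia.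
  move=> i j; rewrite !mem_index_iota => it jt /(congr1 val).
  by rewrite !val_pos; lia.
pose M := \sum_(x <- r) (bnd block_a x).-1 * val x.
have Mn : M <= n.
  apply: leq_trans wn; rewrite /M big_map big_nat [X in _ <= X]big_nat.
  apply: leq_sum => i it; rewrite bnd_block_a val_pos; [|lia..].
  by rewrite /block_weight -mulnA mulnC leq_mul // leq_pred.
(* Copies of the inert part 1 pad the size to exactly [n]. *)
pose c x := if val x == 1 then n - M else (bnd block_a x).-1.
have [la [laE szla]] := mset_of_counts c ur.
have laP x : 1 < val x -> la x <= (bnd block_a x).-1.
  by move=> x1; rewrite laE /c gtn_eqF //; case: ifP.
have Hla : bounded_by_of_size block_a n la.
  split.
    move=> i k ai; have i1 : 1 < val i by apply/supp_block_a; rewrite /supp /= ai.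
    by have := laP i i1; rewrite /bnd ai; have := valP k; lia.
  rewrite szla big_cons /c !val_pos // eqxx muln1 -[RHS](subnK Mn); congr addn.
  rewrite /M !big_map big_nat [RHS]big_nat; apply: eq_bigr => i it.
  by rewrite val_pos ?gtn_eqF //; lia.
have la_block i : s t <= i < s t.+1 -> la (pos i) = (bnd block_a (pos i)).-1.
  move=> it; rewrite laE /c val_pos; last lia.
  rewrite gtn_eqF; last lia.
  by rewrite inE /r map_f ?orbT // mem_index_iota.
have [f [mu [bmu fP fL]]] := ohara_counts block_equiv Hla.
pose G i := block_weight i * (f (pos i)).+1.
have Gphi i : s t <= i < s t.+1 -> G (block_pred i) <= G i.
  move=> it; have i1 : 1 < i by lia.
  have p1 := block_pred_gt1 i1.
  have vi : val (pos i) = i by rewrite val_pos //; lia.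
  have vp : val (pos (block_pred i)) = block_pred i by rewrite val_pos //; lia.
  have phii : block_phi (pos i) = pos (block_pred i) by rewrite /block_phi vi.
  have bi : block i = t by exact: block_uniq.
  have : supp block_a (pos i) by apply/supp_block_a; rewrite vi.
  move=> /fP; rewrite phii la_block; last by rewrite -bi block_predP.
  have : mu (pos (block_pred i)) < bnd block_b (pos (block_pred i)).
    rewrite /bnd; case bp: (block_b _) => [l|]; first exact: bmu bp.
    by move: bp; rewrite /block_b vp p1.
  rewrite bnd_block_a ?vp // bnd_block_b ?vp // block_predK //.
  have Wp := W_gt0 (block_pred i); have pp := block_pred_gt1 p1.
  rewrite /G /block_weight.
  move: (f _) (f _) (mu _) => x y z zlt zE.
  (* At [block_pred i] the run starts from [a - 1] copies and ends with at most [b - 1], so the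
     balance becomes [a * (x + 1) <= b * (y + 1)]; multiplying by the part [block_pred i] turns both
     sides into values of [G]. *)
  have : block_pred (block_pred i) * W (block_pred i) * x.+1 <= i * W i * y.+1.
    rewrite !mulnS; move: zE; case: (_ * W _) (muln_gt0 (block_pred (block_pred i)) (W (block_pred i))); lia.
  move=> /(leq_mul (leqnn (block_pred i))); lia.
have Gc := @cyclic_monotone_constant G (s t) (s t.+1).
have {}Gc i : s t <= i < s t.+1 -> G i = G (s t).
  apply: Gc.
    move=> {}i ti it; have := Gphi i.+1.
    rewrite /block_pred (@block_uniq t); last lia.
    by rewrite gtn_eqF //=; apply; lia.
  have := Gphi (s t); rewrite /block_pred (@block_uniq t); last by rewrite leqnn s_lt.
  by rewrite eqxx; apply; rewrite leqnn s_lt.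
exists (G (s t)); split.
  rewrite /G /block_weight !muln_gt0 W_gt0 andbT /=.
  by have := block_pred_gt1 st1; lia.
move=> i it; rewrite -(Gc i it) /G dvdn_mulr //; split=> //.
rewrite leq_mul // ltnS.
by have := fL [:: pos i]; rewrite big_seq1; apply.
Qed.

End Blocks.

(** * Common multiples *)

(* Induction along the Leibniz harmonic triangle:
   [1 / D x k.+1 = 1 / D x k - 1 / D x.+1 k] for [D x k = x * 'C(x + k, k)]. *)
Lemma dvdn_bin_common_multiple k x G : 0 < x ->
  (forall i, x <= i <= x + k -> i %| G) -> x * 'C(x + k, k) %| G.
Proof.
elim: k x => [|k IHk] x x0 divG.
  by rewrite bin0 muln1; apply: divG; rewrite addn0 leqnn.
have /dvdnP[p Gp] : x * 'C(x + k, k) %| G.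
  by apply: IHk => // i xi; apply: divG; lia.
have /dvdnP[q Gq] : x.+1 * 'C(x.+1 + k, k) %| G.
  by apply: IHk => // i xi; apply: divG; lia.
set D' := x * _.
have D1 : k.+1 * D' = (x + k).+1 * (x * 'C(x + k, k)).
  rewrite /D' mulnCA [RHS]mulnCA addnS; congr (x * _).
  by rewrite (mul_bin_diag (x + k).+1 k).
have D2 : k.+1 * D' = x * (x.+1 * 'C(x.+1 + k, k)).
  rewrite /D' mulnCA addnS addSn; congr (x * _).
  by rewrite mul_bin_left; congr (_ * _); lia.
(* The harmonic identity multiplied by [G * D'], written without subtraction. *)
have Dp : p * D' = q * D' + G.
  apply/eqP; rewrite -(eqn_pmul2l (ltn0Sn k)) mulnDr; apply/eqP.
  rewrite mulnCA D1 [k.+1 * (q * _)]mulnCA D2.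
  rewrite [p * _]mulnCA -Gp [q * _]mulnCA -Gq; lia.
have : D' %| q * D' + G by rewrite -Dp dvdn_mull.
by rewrite dvdn_addr // dvdn_mull.
Qed.

(** Passing from [k] to [k + 1] multiplies the binomial by [(x + k + 1) / (k + 1)], which is at
    least 2 while [k + 1 <= x]. *)
Lemma leq_exp2_bin x k : k <= x -> 2 ^ k <= 'C(x + k, k).
Proof.
elim: k => [|k IHk] kx; first by rewrite bin0.
have /IHk {}IHk : k <= x by exact: ltnW.
rewrite -(leq_pmul2l (ltn0Sn k)) addnS -(mul_bin_diag (x + k).+1 k) /=.
by rewrite expnS mulnCA mulnA leq_mul //; lia.
Qed.

Lemma dvdn_prod_coprime (w : nat -> nat) G K :
  (forall i j, i < j < K -> coprime (w i) (w j)) ->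
  (forall i, i < K -> w i %| G) -> \prod_(0 <= i < K) w i %| G.
Proof.
elim: K => [|K IHK] cop divG; first by rewrite big_geq.
rewrite big_nat_recr //= Gauss_dvd.
  rewrite divG // andbT; apply: IHK => [i j ij|i iK]; first by apply: cop; lia.
  by apply: divG; lia.
rewrite big_nat; elim/big_ind: _ => [|x y cx cy|i iK]; first exact: coprime1n.
  by rewrite coprimeMl cx.
by apply: cop; lia.
Qed.

(** * Lower bounds for the unions of cycles *)

Definition exp_s (t : nat) := 2 ^ t.+1.

Lemma exp_s_lt t : exp_s t < exp_s t.+1.
Proof. by rewrite /exp_s ltn_exp2l. Qed.

Definition exp_length : nat -> nat :=
  ohara_max_length (block_a exp_s (fun=> 1)) (block_b exp_s (fun=> 1))
    (block_phi exp_s).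

(** Put [N = 2 ^ t.+1]. The [N] weights of the block are at most [2 ^ (2 * t + 4)] each, whence the
    bound on [n]. Their common multiple is at least [N * 2 ^ (N - 1)]; giving up half of the
    exponent [N] pays for the division by one weight. *)
Lemma exp_length_lb t n : 3 <= t -> 2 ^ (3 * t + 5) <= n ->
  2 ^ (2 ^ t) <= exp_length n.
Proof.
move=> t3 tn.
have s0 : exp_s 0 = 2 by [].
have N2 : exp_s t.+1 = 2 * exp_s t by rewrite /exp_s expnS.
have N0 : 0 < exp_s t by rewrite /exp_s expn_gt0.
have wP i : exp_s t <= i < exp_s t.+1 ->
    block_weight exp_s (fun=> 1) i <= 2 ^ (2 * t + 4).
  move=> it; have i1 : 1 < i.
    by case/andP: it => + _; apply: leq_trans; exact: s_gt1 s0 exp_s_lt _.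
  have := block_predP s0 exp_s_lt i1; rewrite (block_uniq s0 exp_s_lt it).
  rewrite /block_weight muln1 => pt.
  have -> : 2 ^ (2 * t + 4) = exp_s t.+1 * exp_s t.+1.
    by rewrite /exp_s -expnD; congr (_ ^ _); lia.
  by apply: leq_mul; lia.
have wn : \sum_(exp_s t <= i < exp_s t.+1) block_weight exp_s (fun=> 1) i <= n.
  apply: leq_trans tn; rewrite big_nat.
  apply: (@leq_trans (\sum_(exp_s t <= i < exp_s t.+1) 2 ^ (2 * t + 4))).
    by rewrite [X in _ <= X]big_nat; apply: leq_sum => i; exact: wP.
  rewrite sum_nat_const_nat N2 mul2n -addnn addnK /exp_s -expnD.
  by rewrite leq_exp2l //; lia.
have [G [G0 GP]] := block_counts (W := fun=> 1) s0 exp_s_lt (fun=> isT) wn.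
have : exp_s t * 'C(exp_s t + (exp_s t).-1, (exp_s t).-1) %| G.
  apply: dvdn_bin_common_multiple => // i it.
  have {}it : exp_s t <= i < exp_s t.+1 by lia.
  apply: dvdn_trans (GP i it).1; rewrite /block_weight muln1.
  exact: dvdn_mulr.
move=> /(dvdn_leq G0) GE.
have it : exp_s t <= exp_s t < exp_s t.+1 by rewrite leqnn exp_s_lt.
have := leq_trans GE (GP _ it).2.
have binE := leq_exp2_bin (leq_pred (exp_s t)).
move=> /(leq_trans (leq_mul (leqnn (exp_s t)) binE)).
move=> /leq_trans/(_ (leq_mul (wP _ it) (leqnn _))).
rewrite -/(exp_length n) {1}/exp_s -expnD.
(* This leaves a spare factor 2, which absorbs the successor in [(exp_length n).+1]. *)
have t5 : t + 5 <= 2 ^ t.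
  elim: t t3 {tn N2 N0 wP wn G G0 GP GE it binE} => // t IHt.
  rewrite leq_eqVlt => /predU1P[<-//|/IHt]; rewrite expnS; lia.
have -> : t.+1 + (exp_s t).-1 = (2 * t + 4) + (2 ^ t + (2 ^ t - t - 4)).
  by rewrite /exp_s expnS; lia.
rewrite expnD leq_pmul2l ?expn_gt0 // expnD => le1.
rewrite -ltnS; apply: leq_trans le1.
have : 2 ^ 1 <= 2 ^ (2 ^ t - t - 4) by rewrite leq_exp2l //; lia.
have : 0 < 2 ^ 2 ^ t by rewrite expn_gt0.
by move: (2 ^ 2 ^ t) (2 ^ (_ - _)) => x y; rewrite expn1; nia.
Qed.

Section PolyLength.
Variable m : nat.
Hypothesis m2 : 1 < m.

Definition poly_s (t : nat) := 2 + m * t.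

(* Pairwise coprime inside a block since [m`!] is a multiple of the differences
   of the positions. *)
Definition poly_w (i : nat) := ((i - 2) %% m).+1 * (m`! * 2 ^ ((i - 2) %/ m)) + 1.

(** Block [t] lies below [m * (t + 2)] and its values of [poly_w] are at most [2 * m * 2 ^ t] times
    the factorial of [m]; so its weights are at most [poly_const * (t + 2) ^ 2 * 2 ^ t]. *)
Definition poly_const := 2 * m ^ 3 * m`!.

Lemma poly_const_gt0 : 0 < poly_const.
Proof. by rewrite /poly_const !muln_gt0 fact_gt0 andbT; lia. Qed.

Definition poly_length : nat -> nat :=
  ohara_max_length (block_a poly_s poly_w) (block_b poly_s poly_w)
    (block_phi poly_s).

Lemma poly_s_lt t : poly_s t < poly_s t.+1.
Proof. rewrite /poly_s mulnS; lia. Qed.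

Lemma poly_wE t k : k < m -> poly_w (poly_s t + k) = k.+1 * (m`! * 2 ^ t) + 1.
Proof.
move=> km; rewrite /poly_w /poly_s.
have -> : 2 + m * t + k - 2 = t * m + k by lia.
by rewrite modnMDl divnMDl ?modn_small ?divn_small ?addn0 //; lia.
Qed.

Lemma poly_w_coprime t i j : i < j < m ->
  coprime (poly_w (poly_s t + i)) (poly_w (poly_s t + j)).
Proof.
move=> /andP[ij jm]; rewrite !poly_wE //; last lia.
set M := _ * 2 ^ t.
have cM : coprime (i.+1 * M + 1) M.
  by rewrite coprime_sym /coprime gcdnMDl gcdn1.
(* The first number is prime to [M], hence to the difference [(j - i) * M], because [j - i] divides
   [M]. *)
have -> : j.+1 * M + 1 = (i.+1 * M + 1) + (j - i) * M by nia.
rewrite /coprime gcdnDl -/(coprime _ _) coprimeMr cM andbT.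
apply: coprime_dvdr cM; apply: dvdn_mulr; apply: dvdn_fact; lia.
Qed.

(** The product of the [m] coprime factors [poly_w], each at least [2 ^ t], divides the common
    multiple [G], which is at most a weight times the length plus one. Since [n] can be of order
    [2 ^ t] up to powers of [t], the exponent is [m - 1] up to logarithms. *)
Lemma poly_length_lb t n : m * (poly_const * (t + 2) ^ 2 * 2 ^ t) <= n ->
  2 ^ (t * m) <= poly_const * (t + 2) ^ 2 * 2 ^ t * (poly_length n).+1.
Proof.
move=> tn; set Q := poly_const * _ * _.
have s0 : poly_s 0 = 2 by rewrite /poly_s muln0.
have w0 i : 0 < poly_w i by rewrite /poly_w addn1.
have sS : poly_s t.+1 = poly_s t + m by rewrite /poly_s mulnS; lia.
have wP i : poly_s t <= i < poly_s t.+1 -> block_weight poly_s poly_w i <= Q.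
  move=> it; have i1 : 1 < i.
    by case/andP: it => + _; apply: leq_trans; exact: s_gt1 s0 poly_s_lt _.
  have := block_predP s0 poly_s_lt i1; rewrite (block_uniq s0 poly_s_lt it) => pt.
  have sub : poly_s t.+1 <= m * (t + 2) by rewrite /poly_s; nia.
  have iE : i = poly_s t + (i - poly_s t) by lia.
  have wi : poly_w i <= 2 * (m * (m`! * 2 ^ t)).
    rewrite iE poly_wE; last lia.
    have : (i - poly_s t).+1 * (m`! * 2 ^ t) <= m * (m`! * 2 ^ t).
      by rewrite leq_mul2r; apply/orP; right; lia.
    have : 0 < m * (m`! * 2 ^ t) by rewrite !muln_gt0 fact_gt0 expn_gt0; lia.
    by lia.
  have -> : Q = m * (t + 2) * (m * (t + 2)) * (2 * (m * (m`! * 2 ^ t))).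
    by rewrite /Q /poly_const -!mulnn !expnS expn0; lia.
  by rewrite /block_weight !leq_mul //; lia.
have wn : \sum_(poly_s t <= i < poly_s t.+1) block_weight poly_s poly_w i <= n.
  apply: leq_trans tn; rewrite big_nat.
  apply: (@leq_trans (\sum_(poly_s t <= i < poly_s t.+1) Q)).
    by rewrite [X in _ <= X]big_nat; apply: leq_sum => i; exact: wP.
  by rewrite sum_nat_const_nat sS addKn.
have [G [G0 GP]] := block_counts s0 poly_s_lt w0 wn.
have prodG : \prod_(0 <= i < m) poly_w (poly_s t + i) %| G.
  apply: (dvdn_prod_coprime (w := fun i => poly_w (poly_s t + i))) => [i j|i im].
    exact: poly_w_coprime.
  have {}im : poly_s t <= poly_s t + i < poly_s t.+1 by lia.
  by apply: dvdn_trans (GP _ im).1; exact: dvdn_mull.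
apply: (@leq_trans (\prod_(0 <= i < m) poly_w (poly_s t + i))).
  rewrite expnM -[X in _ ^ X](subn0 m) -prod_nat_const_nat.
  rewrite big_nat [X in _ <= X]big_nat; apply: leq_prod => i im.
  rewrite poly_wE //; have : 0 < i.+1 * m`! by rewrite muln_gt0 fact_gt0.
  by move: (2 ^ t) => x; rewrite mulnA; move: (i.+1 * _) => y; nia.
apply: leq_trans (dvdn_leq G0 prodG) _.
have it : poly_s t <= poly_s t < poly_s t.+1 by rewrite leqnn poly_s_lt.
by apply: leq_trans (GP _ it).2 _; rewrite leq_mul // wP.
Qed.

End PolyLength.

(** * Asymptotics *)

Local Open Scope ring_scope.

Section Asymptotics.
Variable R : realType.

Lemma is_bigOmega_near (f g : nat -> R) (k : R) : 0 < k ->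
  (\forall n \near \oo, k * `|g n| <= `|f n|) -> f \is 'Omega_\oo g.
Proof. by move=> k0 fg; rewrite qualifE; apply/asboolP; exists k. Qed.

Lemma ln_le_harmonic K :
  ln (K.+1%:R : R) <= \sum_(0 <= j < K) (j.+1%:R)^-1.
Proof.
elim: K => [|K IHK]; first by rewrite ln1 big_geq.
have K0 : 0 < K.+1%:R :> R by rewrite ltr0n.
have -> : K.+2%:R = K.+1%:R * (1 + (K.+1%:R)^-1) :> R.
  by rewrite mulrDr mulr1 divff ?lt0r_neq0 // natr1.
have V0 : 0 < K.+1%:R^-1 :> R by rewrite invr_gt0.
rewrite lnM ?posrE ?addr_gt0 // big_nat_recr //=.
by apply: lerD => //; apply: le_ln1Dx; exact: lt_trans (ltrN10 _) V0.
Qed.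

Lemma path_length_omega :
  (fun n : nat => (ohara_max_length path_a path_b path_phi n)%:R : R)
    \is 'Omega_\oo (fun n : nat => n%:R * ln (ln n%:R) : R).
Proof.
(* [56 = 8 * 7], with 8 from [gn] and 7 from [lnK7]. *)
apply: (@is_bigOmega_near _ _ 56^-1); first by rewrite invr_gt0 ltr0n.
near=> n.
have n16 : (16 <= n)%N by near: n; exact: nbhs_infty_ge.
have ne : expR 1 <= n%:R :> R by near: n; exact: nbhs_infty_ger.
have n0 : 0 < n%:R :> R by rewrite ltr0n; lia.
have ln1 : 1 <= ln (n%:R : R) by rewrite -ler_expR lnK.
have lnln0 : 0 <= ln (ln (n%:R : R)) by exact: ln_ge0.
have lnln : ln (ln (n%:R : R)) <= ln n%:R.
  by apply/ltW/ln_sublinear/(lt_le_trans _ ln1).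
rewrite !ger0_norm ?mulr_ge0 // ler_pdivrMl ?ltr0n //.
(* The choice [16 * K ^ 3 <= n] keeps the loss [8 * j.+1 ^ 3] below [n / 2] for all [j < K]. *)
have [|t|t /andP[tn nt]] := @between_consecutive (fun t => 16 * t.+1 ^ 3)%N n.
- by rewrite exp1n muln1.
- by rewrite !expnS expn0; nia.
set K := t.+1 in tn nt.
have [g [gP gL]] := path_counts n.
have gn j : (j < K)%N -> n%:R * (j.+1%:R)^-1 <= 8 * (g j)%:R :> R.
  move=> jK; rewrite ler_pdivrMr ?ltr0n // -!natrM ler_nat.
  have : (8 * j.+1 ^ 3 <= 8 * K ^ 3)%N by rewrite leq_mul2l /= leq_exp2r.
  by have := gP j; nia.
have sumL : n%:R * ln K.+1%:R <= 8 * (ohara_max_length path_a path_b path_phi n)%:R :> R.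
  apply: le_trans (_ : 8 * (\sum_(0 <= j < K) g j)%N%:R <= _); last first.
    by rewrite ler_pM2l ?ltr0n // ler_nat.
  apply: le_trans (ler_wpM2l (ltW n0) (ln_le_harmonic K)) _.
  rewrite natr_sum !mulr_sumr !big_mkord; apply: ler_sum => j _.
  exact: gn.
(* As [K.+1] is at least 2, the factor 16 is at most its fourth power. *)
have lnK7 : ln n%:R <= 7 * ln K.+1%:R :> R.
  rewrite mulr_natl -lnXn ?ltr0n // ler_ln ?posrE ?n0 ?exprn_gt0 ?ltr0n //.
  rewrite -natrX ler_nat; apply: leq_trans (ltnW nt) _.
  have -> : (K.+1 ^ 7 = K.+1 ^ 4 * K.+1 ^ 3)%N by rewrite -expnD.
  by rewrite leq_mul2r; apply/orP; right; rewrite -[16%N]/(2 ^ 4)%N leq_exp2r.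
apply: le_trans (ler_wpM2l (ltW n0) lnln) _.
apply: le_trans (ler_wpM2l (ltW n0) lnK7) _.
by rewrite mulrCA -[56]/((7 * 8)%:R) natrM -mulrA ler_wpM2l.
Unshelve. all: by end_near. Qed.

Lemma exp_length_omega :
  (fun n => ln ((exp_length n)%:R : R)) \is 'Omega_\oo (fun n => n%:R `^ (3^-1) : R)
  /\ \forall n \near \oo, (exp_length n)%:R = expR (ln (exp_length n)%:R) :> R.
Proof.
have ln2 : 0 < ln 2 :> R by rewrite ln_gt0 // ltr1n.
have [N lbN] : exists N, forall n, (N <= n)%N ->
    exists t, (2 ^ 2 ^ t <= exp_length n)%N /\ (n <= (2 ^ t.+3) ^ 3)%N.
  (* The size bound of [exp_length_lb] at its smallest admissible [t], namely 3. *)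
  exists (2 ^ 14)%N => n nN.
  have [//|t|t /andP[tn nt]] :=
      @between_consecutive (fun t => 2 ^ (3 * (t + 3) + 5))%N n.
    apply: leq_trans (ltnW (ltn_expl _ (ltnSn 1))) _; rewrite leq_exp2l //; lia.
  exists (t + 3)%N; split; first by apply: exp_length_lb tn; lia.
  by apply: leq_trans (ltnW nt) _; rewrite -expnM leq_exp2l //; lia.
split.
  apply: (@is_bigOmega_near _ _ (ln 2 / 8)); first by rewrite divr_gt0.
  near=> n.
  have [|t [tL nt]] := lbN n; first by near: n; exact: nbhs_infty_ge.
  have L1 : (1 <= exp_length n)%N by apply: leq_trans tL; rewrite expn_gt0.
  rewrite !ger0_norm ?powR_ge0 ?ln_ge0 ?ler1n //.
  have n3 : n%:R `^ 3^-1 <= (2 ^ t.+3)%N%:R :> R.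
    apply: le_trans (_ : ((2 ^ t.+3) ^ 3)%N%:R `^ 3^-1 <= _).
      by rewrite ge0_ler_powR ?nnegrE ?invr_ge0 // ler_nat.
    by rewrite natrX -powR_mulrn // -powRrM divff // powRr1.
  have lnL : (2 ^ t)%N%:R * ln 2 <= ln (exp_length n)%:R :> R.
    rewrite mulr_natl -lnXn // ler_ln ?posrE ?exprn_gt0 ?ltr0n //.
    by rewrite -natrX ler_nat.
  apply: le_trans lnL; apply: le_trans (ler_wpM2l _ n3) _.
    by rewrite divr_ge0 // ltW.
  rewrite -[t.+3]addn3 expnD natrM -[(2 ^ 3)%N]/8%N.
  by move: (2 ^ t)%N%:R (ln 2) => x y; lra.
near=> n; have [|t [tL _]] := lbN n; first by near: n; exact: nbhs_infty_ge.
by rewrite lnK // posrE ltr0n; apply: leq_trans tL; rewrite expn_gt0.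
Unshelve. all: by end_near. Qed.

(** Raise [c * x <= expR (c * x)] to the power [d]; [c] is chosen so that [d * c = e * ln 2], and
    the shift by 3 goes into the constant. *)
Lemma pow_le_powR_exp2 (e : R) (d : nat) : 0 < e -> (0 < d)%N ->
  exists2 K : R, 0 < K & forall t, (t + 3)%:R ^+ d <= K * (2 ^+ t) `^ e.
Proof.
move=> e0 d0; have ln2 : 0 < ln 2 :> R by rewrite ln_gt0 // ltr1n.
have d0' : 0 < d%:R :> R by rewrite ltr0n.
pose c : R := e * ln 2 / d%:R.
have c0 : 0 < c by rewrite divr_gt0 ?mulr_gt0.
exists (c^-1 ^+ d * expR (3 * (e * ln 2))).
  by rewrite mulr_gt0 ?exprn_gt0 ?invr_gt0 ?expR_gt0.
move=> t; set x : R := (t + 3)%:R.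
have xe : x <= c^-1 * expR (c * x).
  by rewrite ler_pdivlMl //; apply: le_trans (expR_ge1Dx _); rewrite lerDr.
have -> : (2 ^+ t) `^ e = expR (t%:R * (e * ln 2)) :> R.
  by rewrite /powR gt_eqF ?exprn_gt0 // lnXn // -(mulr_natl (ln _)) mulrCA.
apply: le_trans (lerXn2r _ _ _ xe) _; rewrite ?nnegrE ?mulr_ge0 ?invr_ge0 ?expR_ge0 ?(ltW c0) //.
rewrite exprMn -expRM_natl -[leRHS]mulrA -expRD ler_wpM2l ?exprn_ge0 ?invr_ge0 ?(ltW c0) //.
rewrite ler_expR.
have -> : d%:R * (c * x) = x * (e * ln 2) by rewrite /c; field; rewrite lt0r_neq0.
by rewrite /x natrD mulrDl addrC.
Qed.

Lemma poly_length_omega m (eps : R) : (2 <= m)%N -> 0 < eps ->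
  (fun n : nat => (poly_length m n)%:R : R)
    \is 'Omega_\oo (fun n : nat => n%:R `^ (m%:R - 1 - eps) : R).
Proof.
move=> m2 eps0.
have mE : (2 * m = 2 * m.-1 + 2)%N by lia.
(* Lowering [eps] only strengthens the bound, and [e <= 1 / 2] makes [p] positive, so that the power
   [p] of [n] tends to infinity. *)
pose e := Num.min eps 2^-1.
have e0 : 0 < e by rewrite lt_min eps0 invr_gt0 ltr0n.
have m2R : 2 <= m%:R :> R by rewrite ler_nat.
pose p : R := m%:R - 1 - e.
have p0 : 0 < p.
  have : e <= 2^-1 by rewrite ge_min lexx orbT.
  by rewrite /p; lra.
have [K0 K00 K0P] := pow_le_powR_exp2 e0 (d := 2 * m) ltac:(lia).
have P0 := poly_const_gt0 m2.
pose c : R := (poly_const m)%:R.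
have c0 : 0 < c by rewrite ltr0n.
pose K := (2 * m%:R * c) ^+ m.-1 * c * K0.
have Kgt0 : 0 < K by rewrite !mulr_gt0 ?exprn_gt0 ?mulr_gt0 //; lra.
have main n : (m * (poly_const m * 4) <= n)%N ->
    n%:R `^ p <= K * ((poly_length m n)%:R + 1).
  move=> nN.
  have [||t /andP[tn nt]] :=
      @between_consecutive (fun t => m * (poly_const m * (t + 2) ^ 2 * 2 ^ t))%N n.
  - by rewrite muln1.
  - move=> t; apply: leq_trans (ltnW (ltn_expl t (ltnSn 1))) _.
    by rewrite mulnA leq_pmull // muln_gt0 (ltnW m2) muln_gt0 P0 expn_gt0 addn2.
  have := poly_length_lb m2 tn; set L := poly_length m n => Llb.
  pose x : R := (t + 3)%:R; pose y : R := 2 ^+ t.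
  have x0 : 0 < x by rewrite ltr0n; lia.
  have y0 : 0 < y by rewrite exprn_gt0.
  have L0 : 0 <= L%:R + 1 :> R by rewrite natr1.
  (* One factor [y] cancels against the weight bound, which lowers the exponent from [m] to
     [m - 1]. *)
  have {}Llb : y ^+ m.-1 <= c * x ^+ 2 * (L%:R + 1).
    have : (2 ^ (t * m))%N%:R <=
        (poly_const m * (t + 2) ^ 2 * 2 ^ t * L.+1)%N%:R :> R by rewrite ler_nat.
    rewrite 3!natrM !natrX exprM -/y -/c -natr1 => {}Llb.
    rewrite -(ler_pM2l y0) -exprS prednK ?(ltnW m2) //.
    apply: (le_trans Llb).
    rewrite [leLHS](_ : _ = y * (c * (t + 2)%:R ^+ 2 * (L%:R + 1))); last by ring.
    by rewrite ler_pM2l // ler_wpM2r // ler_pM2l // lerXn2r ?nnegrE // /x ler_nat leq_add2l.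
  have {}nt : n%:R <= 2 * m%:R * c * x ^+ 2 * y.
    apply: le_trans (_ : (m * (poly_const m * (t.+1 + 2) ^ 2 * 2 ^ t.+1))%N%:R <= _).
      by rewrite ler_nat ltnW.
    rewrite 3!natrM !natrX [2 ^+ _.+1]exprS -/c -/y addSnnS -/x.
    by rewrite [leLHS](_ : _ = 2 * m%:R * c * x ^+ 2 * y) //; ring.
  have n0 : 0 < n%:R :> R.
    rewrite ltr0n; apply: leq_trans nN.
    by rewrite muln_gt0 (ltnW m2) muln_gt0 P0.
  have yn : y <= n%:R.
    rewrite /y -[2]/(2%:R) -natrX ler_nat; apply: leq_trans tn.
    by rewrite mulnA leq_pmull // muln_gt0 (ltnW m2) muln_gt0 P0 expn_gt0 addn2.
  have ye0 : 0 < y `^ e by exact: powR_gt0.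
  (* Since [y <= n], this factor completes the left side to an integral power of [n]; on the right
     it absorbs the powers of [x], by [K0P]. *)
  rewrite -(ler_pM2r ye0).
  apply: le_trans (_ : n%:R `^ p * n%:R `^ e <= _).
    by rewrite ler_wpM2l ?powR_ge0 // ge0_ler_powR ?nnegrE // ltW.
  rewrite -powRD ?lt0r_neq0 ?implybT // /p subrK.
  have -> : m%:R - 1 = m.-1%:R :> R by rewrite -subn1 natrB // ltnW.
  rewrite powR_mulrn ?(ltW n0) //.
  have nt' : n%:R ^+ m.-1 <= (2 * m%:R * c * x ^+ 2 * y) ^+ m.-1.
    by rewrite lerXn2r ?nnegrE ?mulr_ge0 ?exprn_ge0 // ltW.
  apply: (le_trans nt'); rewrite exprMn [_ ^+ m.-1 * y ^+ _ ]mulrC.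
  have B0 : 0 <= (2 * m%:R * c * x ^+ 2) ^+ m.-1.
    by rewrite exprn_ge0 // !mulr_ge0 ?exprn_ge0 // ltW.
  apply: le_trans (ler_wpM2r B0 Llb) _.
  have -> : c * x ^+ 2 * (L%:R + 1) * (2 * m%:R * c * x ^+ 2) ^+ m.-1 =
      (2 * m%:R * c) ^+ m.-1 * c * (L%:R + 1) * x ^+ (2 * m).
    by rewrite mE exprD exprM exprMn; ring.
  have -> : K * (L%:R + 1) * y `^ e =
      (2 * m%:R * c) ^+ m.-1 * c * (L%:R + 1) * (K0 * y `^ e) by rewrite /K; ring.
  apply: ler_wpM2l; last exact: K0P.
  by rewrite !mulr_ge0 ?exprn_ge0 ?mulr_ge0 // ltW.
(* Once the power [p] of [n] is at least [2 * K], the summand [K] in [main] is at most half of it;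
   hence the doubled constant. *)
have K20 : 0 < 2 * K by rewrite mulr_gt0.
apply: (@is_bigOmega_near _ _ (2 * K)^-1); first by rewrite invr_gt0.
near=> n.
have nN : (m * (poly_const m * 4) <= n)%N by near: n; exact: nbhs_infty_ge.
have n1 : 1 <= n%:R :> R by rewrite ler1n; near: n; exact: nbhs_infty_ge.
have nK : (2 * K) `^ p^-1 <= n%:R by near: n; exact: nbhs_infty_ger.
have {}nK : 2 * K <= n%:R `^ p.
  have := ge0_ler_powR (ltW p0) _ _ nK.
  rewrite -powRrM mulVf ?lt0r_neq0 // powRr1 ?(ltW K20) //.
  by apply; rewrite ?nnegrE ?powR_ge0.
have nL := main n nN.
rewrite !ger0_norm ?powR_ge0 // ler_pdivrMl //.
apply: (@le_trans _ _ (n%:R `^ p)).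
  apply: ler_powR => //; rewrite /p lerD2l lerN2 ge_min lexx //.
move: nL nK; rewrite mulrDr mulr1 -[2 * K * _]mulrA.
by move: (K * _%:R) (n%:R `^ p) => u v; lra.
Unshelve. all: by end_near. Qed.

End Asymptotics.

Theorem theorem3p7 (R : realType) :
  [/\ (exists (a b : extseq) (phi : posint -> posint),
         [/\ phi_equivalent a b phi,
             is_dipath (ohara_vertices a b) (ohara_edge a phi) &
             (fun n : nat => (ohara_max_length a b phi n)%:R : R)
               \is 'Omega_\oo (fun n : nat => n%:R * ln (ln n%:R) : R)]),
      (forall m : nat, (2 <= m)%N ->
         exists (a b : extseq) (phi : posint -> posint),
         [/\ phi_equivalent a b phi,
             only_dicycles_of_length_le m
               (ohara_vertices a b) (ohara_edge a phi) &
             forall eps : R, 0 < eps ->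
               (fun n : nat => (ohara_max_length a b phi n)%:R : R)
                 \is 'Omega_\oo (fun n : nat => n%:R `^ (m%:R - 1 - eps) : R)]) &
      (exists (a b : extseq) (phi : posint -> posint),
         phi_equivalent a b phi /\
         exists2 h : nat -> R,
           h \is 'Omega_\oo (fun n : nat => n%:R `^ (3%:R^-1) : R) &
           \forall n \near \oo,
             (ohara_max_length a b phi n)%:R = expR (h n))].
Proof.
split.
- exists path_a, path_b, path_phi; split.
  + exact: path_equiv.
  + exact: path_is_dipath.
  + exact: path_length_omega.
- move=> m m2; have s0 : poly_s m 0 = 2%N by rewrite /poly_s muln0.
  exists (block_a (poly_s m) (poly_w m)), (block_b (poly_s m) (poly_w m)),
    (block_phi (poly_s m)); split.
  + by apply: block_equiv s0 (poly_s_lt m2) _ => i; rewrite /poly_w addn1.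
  + refine (block_only_dicycles s0 (poly_s_lt m2) _) => t.
    by rewrite /poly_s mulnS addnCA addnC.
  + by move=> eps; exact: poly_length_omega.
- exists (block_a exp_s (fun=> 1%N)), (block_b exp_s (fun=> 1%N)),
    (block_phi exp_s); split.
    by apply: block_equiv => //; exact: exp_s_lt.
  have [h_omega lengthE] := exp_length_omega R.
  by exists (fun n => ln (exp_length n)%:R).
Qed.
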